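(* Let $a>0$ be constant and $\Omega=[x_L,x_R]$. Consider the FR-RBF semidiscretization of $\partial_t u+\partial_x(au)=0$ with boundary condition $u(t,x_L)=g(t)$, i.e. for all $t>0$, $x\in\Omega$ $$\partial_t u_N(t,x) = - f_N'(t,x) - c_L'(x)\left[ f^{\mathrm{num}}_L(t) - f_N(t,x_L) \right] - c_R'(x) \left[ f^{\mathrm{num}}_R(t) - f_N(t,x_R) \right],$$ with $u_N(0,\cdot)=(u_{\mathrm{init}})_N$, where the correction functions $c_L,c_R:\Omega\to\mathbb{R}$ satisfy $$\int_\Omega v \, c_L' \,\mathrm{d}x = - v(x_L), \qquad \int_\Omega v \, c_R' \,\mathrm{d}x = v(x_R)\qquad\text{for all } v\in V_{N,m},$$ and $f^{\mathrm{num}}$ is the upwind flux, $f^{\mathrm{num}}(u,v)=au$ if $a\ge 0$ and $f^{\mathrm{num}}(u,v)=av$ if $a<0$. Then the FR-RBF method is strongly energy stable: there exists $K:[0,\infty)\to[0,\infty)$, bounded for any finite $t$ and independent of $u_{\mathrm{init}}$, $g$ and $N$, such that for every solution $u_N$ and all $t\ge 0$ $$\|u_N(t)\|^2 \leq K(t) \left( \|(u_{\mathrm{init}})_N\|^2 + \max_{s \in [0,t]} |g(s)|^2 \right),$$ where $\|w\|^2=\int_\Omega w(x)^2\,\mathrm{d}x$.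
   Context: RBF space: let $\phi:[0,\infty)\to\mathbb{R}$ be a radial basis function, $m\in\mathbb{N}$, and $X=\{x_n\}_{n=1}^N\subset\Omega$ a set of $N$ distinct centers (for each $N$ under consideration). Let $p_1,\dots,p_Q$ be a basis of the polynomials of degree less than $m$. $V_{N,m}$ is the space of all functions $$v(x)=\sum_{n=1}^N\alpha_n\phi(|x-x_n|)+\sum_{i=1}^Q\beta_ip_i(x)\quad\text{with}\quad \sum_{n=1}^N\alpha_np_i(x_n)=0,\ i=1,\dots,Q.$$ It is assumed that interpolation at the centers is uniquely solvable in $V_{N,m}$ (so $\dim V_{N,m}=N$). The RBF interpolant of a function $w$ is the unique $v\in V_{N,m}$ with $v(x_n)=w(x_n)$ for $n=1,\dots,N$. At each time $t$, $u_N(t,\cdot)\in V_{N,m}$, written $u_N(t)$, is the approximation of the solution, and $f_N(t,\cdot)\in V_{N,m}$ is the corresponding RBF interpolant of the flux $f(u)=au$ (so $f_N=au_N$). $(u_{\mathrm{init}})_N\in V_{N,m}$ is the approximation of the initial condition $u_{\mathrm{init}}$. A prime denotes $\partial_x$ (or $\mathrm{d}/\mathrm{d}x$). Functions in $V_{N,m}$ and the correction functions are continuously differentiable on $\Omega$; $u_N$ is continuous in $t\ge 0$ and continuously differentiable in $t>0$; $g$ is continuous on $[0,\infty)$. Boundary flux values: $f^{\mathrm{num}}_L(t)=f^{\mathrm{num}}(g(t),u_N(t,x_L))$ and $f^{\mathrm{num}}_R(t)=f^{\mathrm{num}}(u_N(t,x_R),u_N(t,x_R))$, since for $a>0$ a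 boundary condition is imposed only at the left boundary. The constant $K(t)$ may depend on the fixed problem data such as $a$. *)

(* Defs.v *)
From HB Require Import structures.
From mathcomp Require Import all_boot all_order all_algebra.
From mathcomp Require Import all_classical all_reals all_analysis.

Set Implicit Arguments.
Unset Strict Implicit.
Unset Printing Implicit Defensive.

Import Order.TTheory GRing.Theory Num.Theory.
Import numFieldNormedType.Exports.

Local Open Scope classical_set_scope.
Local Open Scope ring_scope.

(* Functions on [xL, xR] (resp. on [0, +oo[) are represented by functions
   R -> R of which only the values on that interval matter. In particular
   derivatives with respect to x are taken relative to [xL, xR], so that they
   are one-sided at the two boundary points. *)

Section Calculus.
Context {R : realType}.
Implicit Types (D : set R) (f : R -> R) (x : R).

Definition difference_quotient f x : R -> R := fun y => (f y - f x) / (y - x).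

Definition derivable_within D f x : Prop :=
  cvg (difference_quotient f x @ within D x^').

Definition derive_within D f x : R :=
  lim (difference_quotient f x @ within D x^').

Definition C1_within D f : Prop :=
  (forall x, D x -> derivable_within D f x) /\
  {within D, continuous (derive_within D f)}.

Definition C1_open_halfline f : Prop :=
  {in `]0, +oo[, forall t, derivable f t 1} /\
  {in `]0, +oo[, continuous (derive1 f)}.

Definition L2normsq (xL xR : R) f : R :=
  \int[lebesgue_measure]_(x in `[xL, xR]) (f x ^+ 2).

(* For continuous g the supremum is attained: it is the maximum over [0, t]. *)
Definition max_sq (g : R -> R) (t : R) : R :=
  sup [set `|g s| ^+ 2 | s in `[0, t]].

End Calculus.

Section RBFSpace.
Context {R : realType} (xL xR : R) (phi : R -> R).
Context (m Q : nat) (p : Q.-tuple {poly_m R}).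
Context (N : nat) (X : 'I_N -> R).

(* {poly_m R} is the space of the polynomials of degree less than m. *)
Definition rbf_space : set (R -> R) := [set v |
  exists (alpha : 'I_N -> R) (beta : 'I_Q -> R),
    (forall i, \sum_(n < N) alpha n * (tnth p i : {poly R}).[X n] = 0) /\
    (forall x, x \in `[xL, xR] ->
       v x = \sum_(n < N) alpha n * phi `|x - X n|
             + \sum_(i < Q) beta i * (tnth p i : {poly R}).[x])].

Definition interpolates (y : 'I_N -> R) (v : R -> R) : Prop :=
  rbf_space v /\ forall n, v (X n) = y n.

Definition uniquely_solvable : Prop :=
  forall y : 'I_N -> R,
    (exists v, interpolates y v) /\
    (forall v w, interpolates y v -> interpolates y w ->
       {in `[xL, xR], v =1 w}).

Definition rbf_interpolant (w v : R -> R) : Prop :=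
  interpolates (fun n => w (X n)) v.

Record admissible_rbf_space : Prop := AdmissibleRBFSpace {
  centers_in_domain : forall n, X n \in `[xL, xR];
  centers_distinct : injective X;
  interpolation_unisolvent : uniquely_solvable;
  rbf_space_C1 : forall v, rbf_space v -> C1_within `[xL, xR] v }.

Definition left_correction (cL : R -> R) : Prop :=
  C1_within `[xL, xR] cL /\
  forall v, rbf_space v ->
    \int[lebesgue_measure]_(x in `[xL, xR])
      (v x * derive_within `[xL, xR] cL x) = - v xL.

Definition right_correction (cR : R -> R) : Prop :=
  C1_within `[xL, xR] cR /\
  forall v, rbf_space v ->
    \int[lebesgue_measure]_(x in `[xL, xR])
      (v x * derive_within `[xL, xR] cR x) = v xR.

Definition upwind_flux (a u v : R) : R := if 0 <= a then a * u else a * v.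

(* Time comes first: uN t x is the value of u_N at time t and position x. *)
Record fr_rbf_solution (a : R) (cL cR g uinitN : R -> R) (uN fN : R -> R -> R)
    : Prop := FRRBFSolution {
  solution_in_space : forall t, 0 <= t -> rbf_space (uN t);
  solution_continuous : forall x, x \in `[xL, xR] ->
    {within `[0, +oo[, continuous (fun t => uN t x)};
  solution_C1 : forall x, x \in `[xL, xR] ->
    C1_open_halfline (fun t => uN t x);
  solution_init : {in `[xL, xR], uN 0 =1 uinitN};
  flux_interpolant : forall t, 0 <= t ->
    rbf_interpolant (fun x => a * uN t x) (fN t);
  solution_eq : forall t x, 0 < t -> x \in `[xL, xR] ->
    derive1 (fun s => uN s x) t =
      - derive_within `[xL, xR] (fN t) x
      - derive_within `[xL, xR] cL x
          * (upwind_flux a (g t) (uN t xL) - fN t xL)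
      - derive_within `[xL, xR] cR x
          * (upwind_flux a (uN t xR) (uN t xR) - fN t xR) }.

End RBFSpace.

(* Main.v *)
(* Testing the scheme with u_N, the defining properties of the correction
   functions turn the volume integrals into boundary values:
     d/dt ||u_N||^2 = - a u_N(x_R)^2 + a g^2 - a (u_N(x_L) - g)^2 <= a g^2,
   so that K(t) = 1 + a t works.  Differentiation under the integral is
   avoided: expanding u_N(t) in the cardinal basis of the space, with
   coefficients u_N(t, x_n), makes the energy a quadratic form in these
   coefficients whose Gram matrix does not depend on t. *)
Require Import Defs.
From HB Require Import structures.
From mathcomp Require Import all_boot all_order all_algebra.
From mathcomp Require Import all_classical all_reals all_analysis.
From mathcomp Require Import ring lra.

Set Implicit Arguments.
Unset Strict Implicit.
Unset Printing Implicit Defensive.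

Import Order.TTheory GRing.Theory Num.Theory.
Import numFieldNormedType.Exports.

Local Open Scope classical_set_scope.
Local Open Scope ring_scope.

(** * Derivatives relative to a set *)

(** Off [x], [f y] equals [f x] plus the difference quotient times [y - x]; the quotient converges
    and the second factor tends to 0. *)
Lemma derivable_within_cvg (R : realType) (D : set R) (f : R -> R) (x : R) :
  derivable_within D f x -> f @ within D (nbhs x) --> f x.
Proof.
move=> /cvg_ex[l dfl].
have idx : (fun y : R => y - x) @ within D x^' --> 0.
  rewrite -(subrr x); apply: (@cvg_within_filter _ _ _ x^').
  by apply: cvgB; [exact: nbhs_dnbhs|exact: cvg_cst].
have fx : (fun y => f x + difference_quotient f x y * (y - x))
    @ within D x^' --> f x.
  rewrite -[X in _ --> X]addr0 -(mulr0 l).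
  by apply: cvgD; [exact: cvg_cst|exact: cvgM].
move=> W Wfx.
have := fx _ Wfx; rewrite !near_simpl !near_withinE.
apply: filterS => y Wy Dy.
have [->|yx] := eqVneq y x; first exact: nbhs_singleton.
have := Wy yx Dy; rewrite /= /difference_quotient divfK ?subr_eq0//.
by rewrite addrC subrK.
Qed.

(** Links relative derivatives to the library's two-sided ones: at an interior point of [D],
    restricting the punctured neighbourhoods of [x] to [D] does not change the filter. *)
Lemma is_derive_within (R : realType) (D : set R) (f : R -> R) (x : R) :
  D° x -> derivable_within D f x -> is_derive x 1 f (derive_within D f x).
Proof.
move=> Dx; rewrite /derivable_within /derive_within.
have -> : within D x^' = x^'.
  rewrite eqEsubset; split; last by move=> W; apply: cvg_within.
  move=> W DW; have : nbhs x (fun y => y != x -> D y -> W y) by exact: DW.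
  by apply: filterS2 Dx => y Dy DWy yx; exact: DWy.
move=> df; apply/is_derive1_caratheodory.
set l := lim _.
(* Carathéodory's slope function: the difference quotient, with its limit filled in at [x]. *)
exists (fun y => if y == x then l else difference_quotient f x y).
split; last by rewrite eqxx.
- move=> y; case: eqVneq => [->|yx]; first by rewrite !subrr mulr0.
  by rewrite divfK// subr_eq0.
- apply/continuous_withinNx; rewrite eqxx.
  apply: cvg_trans df; apply: near_eq_cvg.
  near=> y; rewrite ifN//; near: y; exact: nbhs_dnbhs_neq.
Unshelve. all: by end_near. Qed.

(** * Continuity and integration on a segment *)

Section segment.
Context {R : realType} {b1 b2 : R}.
Let mu : measure _ _ := @lebesgue_measure R.
Implicit Types f g : R -> R.

Lemma C1_within_continuous f :
  C1_within `[b1, b2] f -> {within `[b1, b2], continuous f}.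
Proof.
move=> [df _]; apply/subspace_continuousP => x bx.
exact/derivable_within_cvg/df.
Qed.

Lemma within_continuousM f g :
  {within `[b1, b2], continuous f} -> {within `[b1, b2], continuous g} ->
  {within `[b1, b2], continuous (fun x => f x * g x)}.
Proof. by move=> cf cg x; apply: cvgM; [exact: cf|exact: cg]. Qed.

Lemma within_continuous_sum N (D : set R) (F : 'I_N -> R -> R) :
  (forall i, {within D, continuous (F i)}) ->
  {within D, continuous (fun x => \sum_(i < N) F i x)}.
Proof.
move=> cF; elim: N F cF => [|N IH] F cF.
  under eq_fun do rewrite big_ord0.
  by move=> x; exact: cvg_cst.
under eq_fun do rewrite big_ord_recr/=.
move=> x; apply: cvgD; last exact: cF.
by apply: IH => i; exact: cF.
Qed.

Lemma within_continuous_integrable f :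
  {within `[b1, b2], continuous f} -> mu.-integrable `[b1, b2] (EFin \o f).
Proof. by apply: continuous_compact_integrable; exact: segment_compact. Qed.

Lemma Rintegral_sum_continuous N (F : 'I_N -> R -> R) :
  (forall i, {within `[b1, b2], continuous (F i)}) ->
  \int[mu]_(x in `[b1, b2]) (\sum_(i < N) F i x) =
  \sum_(i < N) \int[mu]_(x in `[b1, b2]) F i x.
Proof.
elim: N F => [|N IH] F cF.
  by rewrite big_ord0 /Rintegral integral0_eq// => x _; rewrite big_ord0.
rewrite big_ord_recr/= -IH; last by move=> i; exact: cF.
rewrite -RintegralD//.
- by apply: eq_Rintegral => x _; rewrite big_ord_recr.
- by apply/within_continuous_integrable/within_continuous_sum => i; exact: cF.
- exact/within_continuous_integrable/cF.
Qed.

(** Integrating by parts [f] against its own derivative reproduces the same integral with the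
    opposite sign, so twice the integral is the boundary term. *)
Lemma Rintegral_mul_derive_within f : b1 < b2 -> C1_within `[b1, b2] f ->
  \int[mu]_(x in `[b1, b2]) (f x * derive_within `[b1, b2] f x) =
  (f b2 ^+ 2 - f b1 ^+ 2) / 2.
Proof.
move=> b12 C1f; have [df cdf] := C1f.
have derf x : x \in `]b1, b2[ ->
    is_derive x 1 f (derive_within `[b1, b2] f x).
  move=> xb; apply: is_derive_within; first by rewrite interior_itv.
  by apply: df; exact: subset_itv_oo_cc.
have LR : derivable_oo_LRcontinuous f b1 b2.
  have /(continuous_within_itvP _ b12)[_ fb1 fb2] := C1_within_continuous C1f.
  by split=> // x /derf[].
have dfE : {in `]b1, b2[, derive1 f =1 derive_within `[b1, b2] f}.
  by move=> x /derf[_ <-]; rewrite derive1E.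
have := Rintegration_by_parts b12 cdf LR dfE cdf LR dfE.
under [X in _ = _ - X -> _]eq_Rintegral do rewrite mulrC.
by rewrite /mu !expr2; lra.
Qed.

End segment.

(** * Cardinal basis and Gram matrix of the RBF space *)

Section rbf_space_theory.
Context {R : realType} {xL xR : R} {phi : R -> R} {m Q : nat}.
Context {p : Q.-tuple {poly_m R}} {N : nat} {X : 'I_N -> R}.
Let mu : measure _ _ := @lebesgue_measure R.
Local Notation V := (rbf_space xL xR phi p X).

Lemma rbf_space_lincomb n (c : 'I_n -> R) (v : 'I_n -> R -> R) :
  (forall k, V (v k)) -> V (fun x => \sum_(k < n) c k * v k x).
Proof.
move=> /choice[al] /choice[be] vE.
exists (fun j => \sum_(k < n) c k * al k j).
exists (fun i => \sum_(k < n) c k * be k i); split=> [i|x xI].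
- under eq_bigr do rewrite mulr_suml.
  rewrite exchange_big big1//= => k _.
  under eq_bigr do rewrite -mulrA.
  by rewrite -mulr_sumr (vE k).1 mulr0.
- under eq_bigr => k _ do rewrite (vE k).2// mulrDr !mulr_sumr.
  rewrite big_split/= exchange_big/=; congr (_ + _); last rewrite exchange_big/=.
    apply: eq_bigr => j _; rewrite mulr_suml.
    by apply: eq_bigr => k _; rewrite mulrA.
  apply: eq_bigr => j _; rewrite mulr_suml.
  by apply: eq_bigr => k _; rewrite mulrA.
Qed.

(** [L n] interpolates the Kronecker delta at the centers. The combination of the [L n] with
    coefficients [v (X n)] lies in the space and agrees with [v] at the centers, hence equals [v] on
    the segment by unique solvability. *)
Lemma cardinal_basis : uniquely_solvable xL xR phi p X ->
  exists L : 'I_N -> R -> R, (forall n, V (L n)) /\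
    forall v, V v -> {in `[xL, xR], v =1 fun x => \sum_(n < N) v (X n) * L n x}.
Proof.
move=> US.
have /choice[L LV] (n : 'I_N) := (US (fun k => (k == n)%:R)).1.
exists L; split=> [n|v Vv]; first by case: (LV n).
apply: (US (v \o X)).2; split=> //.
  by apply: rbf_space_lincomb => n; case: (LV n).
move=> k; rewrite (bigD1 k)//= (LV k).2 eqxx mulr1 big1 ?addr0// => n nk.
by rewrite (LV n).2 eq_sym (negbTE nk) mulr0.
Qed.

Definition gram (L : 'I_N -> R -> R) (n k : 'I_N) : R :=
  \int[mu]_(x in `[xL, xR]) (L n x * L k x).

Lemma Rintegral_mul_lincomb (L : 'I_N -> R -> R) (c d : 'I_N -> R)
    (v w : R -> R) :
  (forall n, {within `[xL, xR], continuous (L n)}) ->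
  {in `[xL, xR], v =1 fun x => \sum_(n < N) c n * L n x} ->
  {in `[xL, xR], w =1 fun x => \sum_(n < N) d n * L n x} ->
  \int[mu]_(x in `[xL, xR]) (v x * w x) =
  \sum_(n < N) \sum_(k < N) c n * d k * gram L n k.
Proof.
move=> cL vE wE.
have cLL n k : {within `[xL, xR],
    continuous (fun x => c n * d k * (L n x * L k x))}.
  by apply: within_continuousM; [move=> x; exact: cvg_cst|
    exact: within_continuousM].
transitivity (\int[mu]_(x in `[xL, xR])
    (\sum_(n < N) \sum_(k < N) c n * d k * (L n x * L k x))).
  apply: eq_Rintegral => x /[1!inE] xI; rewrite vE// wE// big_distrlr/=.
  by apply: eq_bigr => n _; apply: eq_bigr => k _; rewrite mulrACA.
rewrite Rintegral_sum_continuous => [|n]; last exact: within_continuous_sum.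
apply: eq_bigr => n _; rewrite Rintegral_sum_continuous//.
apply: eq_bigr => k _; rewrite RintegralZl//.
by apply/within_continuous_integrable/within_continuousM.
Qed.

End rbf_space_theory.

Lemma is_derive_sum_fun (R : realType) N (h : 'I_N -> R -> R) (dh : 'I_N -> R)
    (t : R) : (forall i, is_derive t 1 (h i) (dh i)) ->
  is_derive t 1 (fun s => \sum_(i < N) h i s) (\sum_(i < N) dh i).
Proof. by move=> /is_derive_sum; rewrite fct_sumE. Qed.

(** * Energy rate of the semidiscrete solution *)

Section fr_rbf_energy.
Context {R : realType} {a xL xR : R} {phi : R -> R} {m Q : nat}.
Context {p : Q.-tuple {poly_m R}} {N : nat} {X : 'I_N -> R}.
Context {cL cR g uinitN : R -> R} {uN fN : R -> R -> R}.
Hypotheses (a0 : 0 < a) (xLR : xL < xR).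
Hypothesis adm : admissible_rbf_space xL xR phi p X.
Hypothesis corrL : left_correction xL xR phi p X cL.
Hypothesis sol : fr_rbf_solution xL xR phi p X a cL cR g uinitN uN fN.
Let mu : measure _ _ := @lebesgue_measure R.
Local Notation V := (rbf_space xL xR phi p X).

Lemma rbf_space_continuous v : V v -> {within `[xL, xR], continuous v}.
Proof. by move=> /(rbf_space_C1 adm)/C1_within_continuous. Qed.

(** Scaling the coefficients shows that [a * uN t] is itself in the space, so it is its own
    interpolant. *)
Lemma flux_scale t : 0 <= t -> {in `[xL, xR], fN t =1 fun x => a * uN t x}.
Proof.
move=> t0; apply: (interpolation_unisolvent adm (fun n => a * uN t (X n))).2.
  exact: (flux_interpolant sol).
split=> //; have [al [be [al0 uE]]] := solution_in_space sol t0.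
exists (fun n => a * al n), (fun i => a * be i); split=> [i|x xI].
  by under eq_bigr do rewrite -mulrA; rewrite -mulr_sumr al0 mulr0.
rewrite uE// mulrDr !mulr_sumr.
by congr (_ + _); apply: eq_bigr => i _; rewrite mulrA.
Qed.

(* Testing the scheme with [f_N = a u_N] instead of [u_N] makes the advection
   term [f_N f_N'] and avoids differentiating the identity [f_N = a u_N]. *)
Lemma energy_rate_le t : 0 < t ->
  2 * \int[mu]_(x in `[xL, xR]) (derive1 (uN^~ x) t * uN t x) <= a * g t ^+ 2.
Proof.
move=> t0; have tge := ltW t0.
have xLI : xL \in `[xL, xR] by rewrite in_itv/= lexx ltW.
have xRI : xR \in `[xL, xR] by rewrite in_itv/= lexx ltW.
have [C1cL intcL] := corrL.
have Vf : V (fN t) by have [] := flux_interpolant sol tge.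
have Vu := solution_in_space sol tge.
have C1f := rbf_space_C1 adm Vf.
have cf := rbf_space_continuous Vf.
pose d := a * g t - fN t xL.
pose E1 x := fN t x * derive_within `[xL, xR] (fN t) x.
pose E2 x := fN t x * derive_within `[xL, xR] cL x.
have iE1 : mu.-integrable `[xL, xR] (EFin \o E1).
  by apply/within_continuous_integrable/within_continuousM => //; case: C1f.
have iE2 : mu.-integrable `[xL, xR] (EFin \o (fun x => d * E2 x)).
  apply/within_continuous_integrable/within_continuousM.
    by move=> x; exact: cvg_cst.
  by apply: within_continuousM => //; case: C1cL.
(* Substitute the scheme and [uN = a^-1 * fN]. At the outflow end the upwind flux is
   [a * uN t xR = fN t xR], so the [cR] term vanishes; [d] is the flux jump at the inflow end. *)
have -> : \int[mu]_(x in `[xL, xR]) (derive1 (uN^~ x) t * uN t x) =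
    - a^-1 * \int[mu]_(x in `[xL, xR]) (E1 x + d * E2 x).
  rewrite -RintegralZl//; last by exact: (integrableD _ iE1 iE2).
  apply: eq_Rintegral => x /[1!inE] xI.
  rewrite (solution_eq sol)// /E1 /E2 /d /upwind_flux ltW// !flux_scale//.
  by field; rewrite gt_eqF.
rewrite RintegralD// RintegralZl//; last first.
  by apply/within_continuous_integrable/within_continuousM => //; case: C1cL.
rewrite Rintegral_mul_derive_within// intcL// /d -subr_ge0.
(* Completing the square: the gap between the two sides is the dissipation, a positive multiple of
   the squared outflow flux plus the squared inflow jump. *)
suff -> : a * g t ^+ 2 - 2 * (- a^-1 * ((fN t xR ^+ 2 - fN t xL ^+ 2) / 2 +
    (a * g t - fN t xL) * - fN t xL)) =
    a^-1 * (fN t xR ^+ 2 + (a * g t - fN t xL) ^+ 2).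
  by apply: mulr_ge0; rewrite ?addr_ge0 ?sqr_ge0 ?invr_ge0// ltW.
by field; rewrite gt_eqF.
Qed.

(** [F] is the Gram form in the nodal values. It is matched with the norm only for [0 <= t], where
    [uN t] is known to lie in the space. *)
Lemma L2normsq_solution : exists2 F : R -> R,
  (forall t, 0 <= t -> L2normsq xL xR (uN t) = F t) &
  {within `[0, +oo[, continuous F} /\
  forall t : R, 0 < t -> is_derive t 1 F
    (2 * \int[mu]_(x in `[xL, xR]) (derive1 (uN^~ x) t * uN t x)).
Proof.
have [L [VL LE]] := cardinal_basis (interpolation_unisolvent adm).
have ctL n := rbf_space_continuous (VL n).
have XI := centers_in_domain adm.
exists (fun t => \sum_(n < N) \sum_(k < N)
  uN t (X n) * uN t (X k) * gram (xL := xL) (xR := xR) L n k).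
  move=> t t0; have uE := LE _ (solution_in_space sol t0).
  rewrite /L2normsq; under eq_Rintegral do rewrite expr2.
  by rewrite (Rintegral_mul_lincomb ctL uE uE).
split.
  do 2![apply: within_continuous_sum => ?].
  move=> t; apply: cvgM; last exact: cvg_cst.
  by apply: cvgM; exact: (solution_continuous sol).
move=> t t0.
have du x : x \in `[xL, xR] -> is_derive t 1 (uN^~ x) (derive1 (uN^~ x) t).
  move=> xI; rewrite derive1E; apply: derivableP.
  by have [+ _] := solution_C1 sol xI; apply; rewrite in_itv/= t0.
(* The time derivative has the same cardinal expansion: since [t > 0], the expansion of [uN s] holds
   for all [s] near [t] and can be differentiated term by term. *)
have utE : {in `[xL, xR], (fun x => derive1 (uN^~ x) t) =1
    fun x => \sum_(n < N) derive1 (uN^~ (X n)) t * L n x}.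
  move=> x xI; have [_ <-] := du x xI.
  suff [_ ->] : is_derive t 1 (uN^~ x)
    (\sum_(n < N) derive1 (uN^~ (X n)) t * L n x) by [].
  apply: (@near_eq_is_derive _ _ _
    (fun s => \sum_(n < N) uN s (X n) * L n x)).
    near=> s; rewrite (LE (uN s))//; apply: (solution_in_space sol).
    by near: s; exact: (lt_le_nbhsr t0).
  apply: is_derive_sum_fun => n; have := is_deriveZ (L n x) (du _ (XI n)).
  rewrite [X in is_derive _ _ _ X]mulrC; congr is_derive.
  by apply/funext => s; rewrite /= mulrC.
rewrite (Rintegral_mul_lincomb ctL utE (LE _ (solution_in_space sol (ltW t0)))).
set G := gram L.
(* Symmetry of the Gram matrix splits the doubled sum into the two terms of the product rule. *)
have -> : 2 * (\sum_(n < N) \sum_(k < N)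
      derive1 (uN^~ (X n)) t * uN t (X k) * G n k) =
    \sum_(n < N) \sum_(k < N) G n k * (uN t (X n) * derive1 (uN^~ (X k)) t +
      uN t (X k) * derive1 (uN^~ (X n)) t).
  under [RHS]eq_bigr => n _ do
    (under eq_bigr => k _ do rewrite mulrDr; rewrite big_split/=).
  rewrite big_split/= [in RHS]exchange_big/= mulr_natl mulr2n.
  congr (_ + _); apply: eq_bigr => n _; apply: eq_bigr => k _; last by ring.
  have -> : G k n = G n k.
    by apply: eq_Rintegral => x _; rewrite mulrC.
  by ring.
apply: is_derive_sum_fun => n; apply: is_derive_sum_fun => k.
rewrite (_ : (fun s => _) = G n k \*: (uN^~ (X n) * uN^~ (X k))); last first.
  by apply/funext => s; rewrite mulrC.
by apply: is_deriveZ; apply: is_deriveM; exact: du.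
Unshelve. all: by end_near. Qed.

End fr_rbf_energy.

(** * Bound on the boundary data and the final estimate *)

(** A [sup] dominates the elements only of a bounded set; boundedness comes from the extreme value
    theorem applied to [g * g]. *)
Lemma max_sq_ub (R : realType) (g : R -> R) (t : R) :
  {within `[0, +oo[, continuous g} ->
  forall s, s \in `[0, t] -> g s ^+ 2 <= max_sq g t.
Proof.
move=> cg s st; have t0 : 0 <= t.
  by move: st; rewrite in_itv/= => /andP[]; exact: le_trans.
have cg2 : {within `[0, t], continuous (fun s => g s * g s)}.
  apply: within_continuousM; apply: continuous_subspaceW cg => y /=;
  by rewrite !in_itv/= => /andP[->].
have [c _ gc] := EVT_max t0 cg2.
rewrite -(real_normK (num_real (g s))); apply: ub_le_sup; last by exists s.
exists (g c * g c) => _ [y yt <-]; rewrite real_normK ?num_real// expr2; exact: gc.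
Qed.

Theorem theorem4p2 (R : realType) (a xL xR : R) (phi : R -> R) (m Q : nat)
    (p : Q.-tuple {poly_m R}) :
  0 < a -> xL < xR -> basis_of fullv p ->
  exists K : R -> R,
    (forall t, 0 <= t -> 0 <= K t) /\
    (forall T, 0 <= T -> exists M, forall t, 0 <= t <= T -> K t <= M) /\
    forall (N : nat) (X : 'I_N -> R) (cL cR : R -> R)
           (g uinitN : R -> R) (uN fN : R -> R -> R),
      admissible_rbf_space xL xR phi p X ->
      left_correction xL xR phi p X cL ->
      right_correction xL xR phi p X cR ->
      {within `[0, +oo[, continuous g} ->
      rbf_space xL xR phi p X uinitN ->
      fr_rbf_solution xL xR phi p X a cL cR g uinitN uN fN ->
      forall t, 0 <= t ->
        L2normsq xL xR (uN t) <= K t * (L2normsq xL xR uinitN + max_sq g t).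
Proof.
move=> a0 xLR _; exists (fun t => 1 + a * t); split; last split.
- by move=> t t0; rewrite addr_ge0// mulr_ge0// ltW.
- move=> T _; exists (1 + a * T) => t /andP[_ tT].
  by rewrite lerD2l ler_wpM2l// ltW.
move=> N X cL cR g uinitN uN fN adm corrL _ cg _ sol t t0.
have [F FE [cF dF]] := L2normsq_solution adm sol.
have uinitE : L2normsq xL xR uinitN = F 0.
  rewrite -FE//; apply: eq_Rintegral => x /[1!inE] xI.
  by rewrite (solution_init sol).
have F0 : 0 <= F 0 by rewrite -FE//; apply: Rintegral_ge0 => x _; exact: sqr_ge0.
have gM := max_sq_ub cg.
have M0 : 0 <= max_sq g t.
  by apply: (le_trans (sqr_ge0 (g 0))); apply: gM; rewrite in_itv/= lexx.
(* This is sharper than the claim: multiplying out the factor [1 + a * t] leaves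
   [max_sq g t + a * t * F 0], which is nonnegative, to spare. *)
suff Ft : F t <= F 0 + a * t * max_sq g t.
  rewrite uinitE FE// mulrDl mul1r mulrDr; apply: (le_trans Ft).
  rewrite -subr_ge0.
  have -> : F 0 + max_sq g t + (a * t * F 0 + a * t * max_sq g t) -
    (F 0 + a * t * max_sq g t) = max_sq g t + a * t * F 0 by ring.
  by rewrite addr_ge0// !mulr_ge0// ltW.
have [->|t_neq0] := eqVneq t 0; first by rewrite mulr0 mul0r addr0.
have tgt0 : 0 < t by rewrite lt_def t_neq0.
(* The mean value theorem replaces integration in time: the increment of [F] is [t] times its rate
   at some [c] in []0, t[], and that rate is at most [a * g c ^+ 2]. *)
have [||c] := MVT tgt0 (f := F) (df := fun s =>
    2 * \int[lebesgue_measure]_(x in `[xL, xR])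
      (derive1 (uN^~ x) s * uN s x)).
- by move=> s; rewrite in_itv/= => /andP[s0 _]; exact: dF.
- by apply: continuous_subspaceW cF => y /=; rewrite !in_itv/= => /andP[->].
rewrite in_itv/= => /andP[c0 ct]; rewrite subr0 -lerBlDl => ->.
rewrite (mulrAC a t) ler_wpM2r//.
apply: (le_trans (energy_rate_le a0 xLR adm corrL sol c0)).
by apply: (ler_wpM2l (ltW a0)); apply: gM; rewrite in_itv/= !ltW.
Qed.
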